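(* Let $p$ be any prime and let $G=Q_{4p}$. (a) If $p=2$ then $$\mathrm{Spec}(\mathcal{B}(G))=\left\{(0)^{58}, (-1)^1, (1)^1, (-\sqrt{3})^1, (\sqrt{3})^1, (-\sqrt{12})^3, (\sqrt{12})^3, (-\sqrt{24})^1, (\sqrt{24})^1\right\},$$ $$\mathrm{L\text{-}spec}(\mathcal{B}(G))=\left\{(0)^6, (1)^{58}, (2)^1, (4)^1, (13)^3, (25)^1\right\}=\mathrm{Q\text{-}spec}(\mathcal{B}(G)),$$ and $$\mathrm{CN\text{-}spec}(\mathcal{B}(G))=\left\{(-1)^{58}, (0)^7, (2)^1, (11)^3, (23)^1\right\}.$$ (b) If $p\geq 3$ then $$\mathrm{Spec}(\mathcal{B}(G))=\Big\{(-1)^1, (0)^{16p^2-p-5}, (1)^1, (-\sqrt{3})^1, (\sqrt{3})^1, (-\sqrt{12})^p, (\sqrt{12})^p, (-\sqrt{p^2-1})^1, (\sqrt{p^2-1})^1,$$ $$\qquad (-\sqrt{3p^2-3})^1, (\sqrt{3p^2-3})^1, (-\sqrt{12p^2-12p})^1, (\sqrt{12p^2-12p})^1\Big\},$$ $$\mathrm{L\text{-}spec}(\mathcal{B}(G))=\left\{(0)^{p+5}, (1)^{16p^2-p-5}, (2)^1, (4)^1, (13)^p, (p^2)^1, (3p^2-2)^1, (12p^2-12p+1)^1\right\}=\mathrm{Q\text{-}spec}(\mathcal{B}(G)),$$ and $$\mathrm{CN\text{-}spec}(\mathcal{B}(G))=\left\{(-1)^{16p^2-p-5}, (0)^{p+6},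 (2)^1, (11)^p, (p^2-2)^1, (3p^2-4)^1, (12p^2-12p-1)^1\right\}.$$
   Context: $Q_{4m}=\langle a,b : a^{2m}=1,\ b^2=a^m,\ bab^{-1}=a^{-1}\rangle$ is the dicyclic group of order $4m$. For a finite group $G$, let $L(G)$ be the set of all subgroups of $G$. The subgroup generating bipartite graph $\mathcal{B}(G)$ is the simple bipartite graph with vertex set the disjoint union of $G\times G$ and $L(G)$, in which $(a,b)\in G\times G$ and $H\in L(G)$ are adjacent if and only if $H$ is the subgroup generated by $a$ and $b$ (and there are no other edges). For a finite simple graph $\Gamma$ with vertices $v_1,\dots,v_n$, let $A$ be its adjacency matrix and $D$ its diagonal degree matrix. $\mathrm{Spec}(\Gamma)$, $\mathrm{L\text{-}spec}(\Gamma)$ and $\mathrm{Q\text{-}spec}(\Gamma)$ denote the multisets of eigenvalues (with multiplicity) of $A$, $D-A$ and $D+A$ respectively. The common neighborhood matrix $CN(\Gamma)$ has $(i,j)$ entry, for $i\ne j$, equal to the number of vertices other than $v_i,v_j$ adjacent to both $v_i$ and $v_j$, and zero diagonal; $\mathrm{CN\text{-}spec}(\Gamma)$ is the multiset of its eigenvalues. The notation $\{(x_1)^{n_1},\dots,(x_k)^{n_k}\}$ denotes the multiset in which $x_i$ is listed $n_i$ times; if some $x_i$ coincide for a particular $p$, their multiplicities are added. *)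

(* Defs.v *)
From HB Require Import structures.
From mathcomp Require Import all_boot all_order all_fingroup all_algebra.

Set Implicit Arguments.
Unset Strict Implicit.
Unset Printing Implicit Defensive.

Import GRing.Theory.
Local Open Scope ring_scope.

(* For a finite abstract presentation, [\isog Grp] characterizes the presented
   group up to isomorphism; it constrains the whole carrier of gT. *)
Definition dicyclic (m : nat) (gT : finGroupType) : Prop :=
  ([set: gT] \isog Grp (a : b :
     (a ^+ (2 * m)%N = 1, b ^+ 2 = a ^+ m, b * a * b^-1 = a^-1)))%g.

Record sgraph (V : finType) := SGraph {
  adj :> rel V;
  adj_sym : symmetric adj;
  adj_irr : irreflexive adj }.

(* As every subgroup of the group gT is an element of {group gT}, this sum is
   the disjoint union of G x G and L(G). *)
Definition sgbg_vertex (gT : finGroupType) : finType :=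
  ((gT * gT) + {group gT})%type.

Definition sgbg_adj (gT : finGroupType) : rel (sgbg_vertex gT) :=
  fun u v => match u, v with
  | inl (a, b), inr H | inr H, inl (a, b) =>
      <<[set a; b]>>%g == (H : {set gT})
  | _, _ => false
  end.

Lemma sgbg_adj_sym gT : symmetric (@sgbg_adj gT).
Proof. by move=> [[a b]|H] [[c d]|K]. Qed.

Lemma sgbg_adj_irr gT : irreflexive (@sgbg_adj gT).
Proof. by move=> [[a b]|H]. Qed.

Definition sgbg (gT : finGroupType) : sgraph (sgbg_vertex gT) :=
  SGraph (@sgbg_adj_sym gT) (@sgbg_adj_irr gT).

Section GraphMatrices.
Variables (R : nzRingType) (V : finType) (e : sgraph V).

Definition degree (u : V) : nat := #|[set w | e u w]|.

Definition common_neighbors (u v : V) : {set V} :=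
  [set w | [&& w != u, w != v, e u w & e v w]].

(* Vertices are numbered by [enum_val]. *)
Definition adjacency_mx : 'M[R]_#|V| :=
  \matrix_(i, j) (e (enum_val i) (enum_val j))%:R.

Definition degree_mx : 'M[R]_#|V| :=
  diag_mx (\row_i (degree (enum_val i))%:R).

Definition laplacian_mx : 'M[R]_#|V| := degree_mx - adjacency_mx.

Definition signless_laplacian_mx : 'M[R]_#|V| := degree_mx + adjacency_mx.

Definition cn_mx : 'M[R]_#|V| :=
  \matrix_(i, j) if i == j then 0
                 else #|common_neighbors (enum_val i) (enum_val j)|%:R.

End GraphMatrices.

(* The eigenvalues listed with their algebraic multiplicity (in an unspecified
   order, so that lists are to be compared with [perm_eq]). *)
Definition eigenvalues (C : closedFieldType) (n : nat) (M : 'M[C]_n) : seq C :=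
  sval (closed_field_poly_normal (char_poly M)).

Lemma char_poly_eigenvalues (C : closedFieldType) n (M : 'M[C]_n) :
  char_poly M = \prod_(x <- eigenvalues M) ('X - x%:P).
Proof.
rewrite /eigenvalues; case: closed_field_poly_normal => r /= {1}->.
by rewrite (monicP (char_poly_monic M)) scale1r.
Qed.

Lemma mem_eigenvalues (C : closedFieldType) n (M : 'M[C]_n) a :
  (a \in eigenvalues M) = eigenvalue M a.
Proof.
by rewrite eigenvalue_root_char char_poly_eigenvalues root_prod_XsubC.
Qed.

Section Spectra.
Variables (C : closedFieldType) (V : finType) (e : sgraph V).

Definition Spec : seq C := eigenvalues (adjacency_mx C e).
Definition L_spec : seq C := eigenvalues (laplacian_mx C e).
Definition Q_spec : seq C := eigenvalues (signless_laplacian_mx C e).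
Definition CN_spec : seq C := eigenvalues (cn_mx C e).

End Spectra.

(* Main.v *)
Require Import Defs.
From mathcomp Require Import all_boot all_order all_fingroup all_algebra cyclic.
From mathcomp Require Import zify ring.

(** Every pair of elements generates exactly one subgroup, so the graph is a
    disjoint union of stars: the centre of a star is a subgroup [H], and its
    leaves are the pairs that generate [H]. Two ingredients give the spectra.

    Linear algebra. Let [N] be the incidence matrix between leaves and centres.
    [N^T *m N] is diagonal and lists the numbers of leaves
    ([incidence_mx_gram]). The adjacency matrix and both Laplacians have a scalar
    block on the leaves, so a Schur complement turns their characteristic
    polynomials into products of one quadratic factor per star
    ([char_poly_weighted_star]). The common-neighborhood matrix is [N *m N^T - 1]
    on the leaves, and Sylvester's identity gives its characteristic polynomial
    ([char_poly_common_star]). A star with [n] leaves thus contributes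
    the square roots of [n] to the spectrum, [0] and [n + 1] to both Laplacian
    spectra, [0] and [n - 1] to the common-neighborhood spectrum. The remaining
    eigenvalues, one per leaf in excess of the number of centres, are all equal
    to [0], [1] and [-1] respectively.

    Group theory. It remains to list the numbers of generating pairs of the
    subgroups ([dicyclic_star_sizes]). A concrete permutation model shows that
    the presentation does define a group of order [4 * p], with a cyclic subgroup
    [<[a]>] of order [2 * p] and index [2]; all elements outside it have order [4]
    and the same square [a ^+ p]. As [p] is prime, a subgroup is either contained
    in [<[a]>], or one of the [p] cyclic subgroups of order [4] generated by
    [a ^+ i * b], or the whole group ([dicyclic_subgroupP]). Sorting the pairs of
    elements of a subgroup by the subgroup that they generate ([sum_gen_pairs])
    then determines all the numbers: [1] and [3] for orders [1] and [2], [12] for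
    cyclic groups of order [4], [p ^ 2 - 1] and [3 * p ^ 2 - 3] for orders [p] and
    [2 * p] with [p] odd, and what is left of the [16 * p ^ 2] pairs for the whole
    group. *)

Set Implicit Arguments.
Unset Strict Implicit.
Unset Printing Implicit Defensive.

Import GRing.Theory Num.Theory.

(** * Determinants and characteristic polynomials *)

Section CharPoly.
Local Open Scope ring_scope.

Section BlockDeterminants.
Variables (R : comNzRingType) (m k : nat).
Implicit Types (c : R) (N : 'M[R]_(m, k)) (P : 'M[R]_(k, m)) (E : 'M[R]_k).

(** Schur complement without division: multiplying on the right by the block
    matrix [1, -N; 0, c] makes the product block lower triangular. The factor
    [c ^+ k] replaces the division by [c], as [c] will be a polynomial. *)
Lemma det_block_scalar_ul c N P E :
  \det (block_mx c%:M N P E) * c ^+ k = c ^+ m * \det (c *: E - P *m N).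
Proof.
have <- : \det (block_mx 1%:M (- N) 0 c%:M : 'M_(m + k)) = c ^+ k.
  by rewrite det_ublock det1 mul1r det_scalar.
rewrite -det_mulmx mulmx_block !mulmx1 !mulmx0 !addr0 !mulmxN !mul_mx_scalar.
rewrite mul_scalar_mx addNr det_lblock det_scalar.
by rewrite [- (P *m N) + _]addrC.
Qed.

(** Sylvester's determinant identity in homogeneous form: both sides are
    [c ^+ k] times the determinant of [c, N; P, 1], computed by eliminating
    either diagonal block. *)
Lemma det_scalar_sub_mulmxC c N P :
  \det (c%:M - N *m P) * c ^+ k = c ^+ m * \det (c%:M - P *m N).
Proof.
rewrite -[X in _ * \det (X - _)]scalemx1 -det_block_scalar_ul; congr (_ * _).
rewrite -[LHS]mulr1 -[X in _ * X](det1 R k) -(det_ublock _ N).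
have det_lower : \det (block_mx 1%:M 0 (- P) 1%:M : 'M_(m + k)) = 1.
  by rewrite det_lblock !det1 mulr1.
rewrite -[RHS]mulr1 -[X in _ = _ * X]det_lower -det_mulmx mulmx_block.
by rewrite !mulmx1 !mulmx0 !add0r !mulmxN mul1mx subrr.
Qed.

End BlockDeterminants.

Lemma char_poly_mx_block (R : comNzRingType) m k (A : 'M[R]_m) B D (E : 'M[R]_k) :
  char_poly_mx (block_mx A B D E) =
  block_mx (char_poly_mx A) (- map_mx polyC B)
           (- map_mx polyC D) (char_poly_mx E).
Proof.
rewrite /char_poly_mx map_block_mx scalar_mx_block opp_block_mx add_block_mx.
by rewrite !add0r.
Qed.

(** Two numberings of the same vertex set differ by a permutation of the rows
    and columns; the two sizes are different expressions of the same number. *)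
Lemma char_poly_reindex (R : comNzRingType) (V : finType) n1 n2
    (f : 'I_n1 -> V) (g : 'I_n2 -> V) (F : V -> V -> R) :
  bijective f -> bijective g ->
  char_poly (\matrix_(i, j) F (f i) (f j)) =
  char_poly (\matrix_(i, j) F (g i) (g j)).
Proof.
move=> bij_f bij_g.
have En : n1 = n2.
  rewrite -(card_ord n1) -(card_ord n2).
  by rewrite (bij_eq_card bij_f) (bij_eq_card bij_g).
case: n2 / En g bij_g => g bij_g.
have [f' fK f'K] := bij_f; have [g' gK g'K] := bij_g.
have inj_s : injective (fun i => g' (f i)).
  by move=> i j /(can_inj g'K) /(can_inj fK).
pose s := perm inj_s.
have -> : \matrix_(i, j) F (f i) (f j) =
   row_perm s (col_perm s (\matrix_(i, j) F (g i) (g j))).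
  by apply/matrixP => i j; rewrite !mxE !permE !g'K.
rewrite /char_poly.
set M := \matrix_(i, j) F (g i) (g j).
have -> : char_poly_mx (row_perm s (col_perm s M)) =
   row_perm s (col_perm s (char_poly_mx M)).
  by apply/matrixP => i j; rewrite !mxE (inj_eq perm_inj).
rewrite row_permE col_permE !det_mulmx !det_perm mulrCA -signr_addb odd_permV.
by rewrite addbb mulr1.
Qed.

Lemma char_poly_sum_type (R : comNzRingType) (L S : finType)
    (F : L + S -> L + S -> R) :
  char_poly (\matrix_(i < #|{: L + S}|, j < #|{: L + S}|)
     F (enum_val i) (enum_val j)) =
  char_poly (block_mx
    (\matrix_(i < #|L|, j < #|L|) F (inl (enum_val i)) (inl (enum_val j)))
    (\matrix_(i < #|L|, j < #|S|) F (inl (enum_val i)) (inr (enum_val j)))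
    (\matrix_(i < #|S|, j < #|L|) F (inr (enum_val i)) (inl (enum_val j)))
    (\matrix_(i < #|S|, j < #|S|) F (inr (enum_val i)) (inr (enum_val j)))).
Proof.
pose g (i : 'I_(#|L| + #|S|)) : L + S :=
  match split i with inl j => inl (enum_val j) | inr j => inr (enum_val j) end.
pose h (u : L + S) : 'I_(#|L| + #|S|) :=
  match u with
  | inl l => lshift _ (enum_rank l)
  | inr s => rshift _ (enum_rank s)
  end.
have gl i : g (lshift _ i) = inl (enum_val i) by rewrite /g (unsplitK (inl i)).
have gr i : g (rshift _ i) = inr (enum_val i) by rewrite /g (unsplitK (inr i)).
have bij_g : bijective g.
  exists h => [i | [l|s]] /=; last 2 first.
  - by rewrite gl enum_rankK.
  - by rewrite gr enum_rankK.
  by case: (split_ordP i) => j ->; rewrite ?gl ?gr /= enum_valK.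
rewrite (char_poly_reindex F (@enum_val_bij _) bij_g); congr char_poly.
apply/matrixP => i j.
case: (split_ordP i) => i' ->; case: (split_ordP j) => j' ->;
by rewrite ?block_mxEul ?block_mxEur ?block_mxEdl ?block_mxEdr !mxE ?gl ?gr.
Qed.

End CharPoly.

(** * Spectra of disjoint unions of stars *)

(** From here on [f : L -> S] describes a disjoint union of stars: the leaf [l]
    is attached to the centre [f l]. *)
Section StarForest.
Local Open Scope ring_scope.
Variables (L S : finType) (f : L -> S).

Definition leaves (s : S) : nat := #|[set l | f l == s]|.

Section Incidence.
Variable R : comNzRingType.

Definition incidence_mx : 'M[R]_(#|L|, #|S|) :=
  \matrix_(i, j) (f (enum_val i) == enum_val j)%:R.

(** Every leaf has a single centre, so distinct columns of the incidence matrix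
    have disjoint supports. *)
Lemma incidence_mx_gram :
  incidence_mx^T *m incidence_mx =
  diag_mx (\row_j (leaves (enum_val j))%:R).
Proof.
apply/matrixP => i j; rewrite !mxE.
under eq_bigr do rewrite !mxE -natrM mulnb.
rewrite -(big_enum_val
  (fun l => ((f l == enum_val i) && (f l == enum_val j))%:R)) /=.
have [<-|neq_ij] := eqVneq i j.
  rewrite mulr1n /leaves -sum1dep_card natr_sum big_mkcond [RHS]big_mkcond /=.
  by apply: eq_bigr => l _; rewrite andbb; case: eqP.
rewrite mulr0n big1 // => l _; case: eqP => //= ->.
by rewrite (inj_eq enum_val_inj) (negPf neq_ij).
Qed.

End Incidence.

Variable R : comNzRingType.

(** Common shape of the adjacency matrix ([c = 0], [d = 0], [eps = 1]) and of
    both Laplacians ([c = 1], [d] the number of leaves, [eps = -1] or [1]) *)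
Definition weighted_star (c eps : R) (d : S -> R) (u v : L + S) : R :=
  match u, v with
  | inl l, inl l' => c *+ (l == l')
  | inl l, inr s | inr s, inl l => eps *+ (f l == s)
  | inr s, inr s' => d s *+ (s == s')
  end.

(** The Schur complement of the leaf block is diagonal because
    the Gram matrix of the incidence matrix is, and [eps] enters it only through
    its square; this is why both Laplacians have the same spectrum. *)
Lemma char_poly_weighted_star c eps d : eps * eps = 1 ->
  char_poly (\matrix_(i < #|{: L + S}|, j < #|{: L + S}|)
     weighted_star c eps d (enum_val i) (enum_val j)) * ('X - c%:P) ^+ #|S| =
  ('X - c%:P) ^+ #|L| *
  \prod_(s : S) (('X - c%:P) * ('X - (d s)%:P) - (leaves s)%:R).
Proof.
move=> eps2; rewrite char_poly_sum_type /char_poly char_poly_mx_block /=.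
set A := char_poly_mx _; set B := - _; set B' := - _; set E := char_poly_mx _.
have -> : A = ('X - c%:P)%:M.
  apply/matrixP => i j; rewrite !mxE (inj_eq enum_val_inj) rmorphMn.
  by case: eqP; rewrite ?subr0.
have -> : E = diag_mx (\row_j ('X - (d (enum_val j))%:P)).
  apply/matrixP => i j; rewrite !mxE (inj_eq enum_val_inj) rmorphMn.
  by case: eqP => [->|]; rewrite ?subr0.
have -> : B = (- eps%:P) *: incidence_mx {poly R}.
  by apply/matrixP => i j; rewrite !mxE rmorphMn /= mulNr mulr_natr.
have -> : B' = (- eps%:P) *: (incidence_mx {poly R})^T.
  by apply/matrixP => i j; rewrite !mxE rmorphMn /= mulNr mulr_natr.
rewrite det_block_scalar_ul -scalemxAl -scalemxAr scalerA mulrNN -rmorphM eps2.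
rewrite scale1r incidence_mx_gram.
set M := (X in \det X).
have -> : M = diag_mx (\row_j (('X - c%:P) * ('X - (d (enum_val j))%:P) -
                               (leaves (enum_val j))%:R)).
  by apply/matrixP => i j; rewrite !mxE mulrnAr -mulrnBl.
rewrite det_diag (eq_bigr _ (fun i _ => mxE _ _ _ _)).
by rewrite -(big_enum_val
  (fun s => ('X - c%:P) * ('X - (d s)%:P) - (leaves s)%:R)).
Qed.

(** Common-neighborhood matrix of a union of stars: two distinct leaves have one
    common neighbor when they are attached to the same centre, and no other pair
    of vertices has any. Subtracting the identity clears the diagonal. *)
Definition common_star (u v : L + S) : R :=
  match u, v with
  | inl l, inl l' => (f l == f l')%:R - (l == l')%:R
  | _, _ => 0
  end.

(** The leaf block is [N *m N^T - 1] for the incidence matrix [N], so Sylvester's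
    identity brings it back to the diagonal matrix [N^T *m N]. *)
Lemma char_poly_common_star :
  char_poly (\matrix_(i < #|{: L + S}|, j < #|{: L + S}|)
     common_star (enum_val i) (enum_val j)) * ('X + 1) ^+ #|S| =
  'X ^+ #|S| * ('X + 1) ^+ #|L| * \prod_(s : S) ('X + 1 - (leaves s)%:R).
Proof.
rewrite char_poly_sum_type /char_poly char_poly_mx_block /=.
set A := char_poly_mx _; set B := - _; set B' := - _; set E := char_poly_mx _.
have -> : A = ('X + 1)%:M - incidence_mx {poly R} *m (incidence_mx {poly R})^T.
  apply/matrixP => i j; rewrite !mxE (inj_eq enum_val_inj) rmorphB !rmorph_nat.
  under eq_bigr do rewrite !mxE -natrM mulnb.
  rewrite -(big_enum_val
    (fun s => ((f (enum_val i) == s) && (f (enum_val j) == s))%:R)) /=.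
  rewrite (bigD1 (f (enum_val i))) //= eqxx big1 /=; last first.
    by move=> s; rewrite eq_sym => /negPf ->.
  rewrite addr0 [f (enum_val j) == _]eq_sym.
  by case: (i == j); rewrite ?mulr1n ?mulr0n; ring.
have -> : E = 'X%:M.
  by apply/matrixP => i j; rewrite !mxE subr0.
have -> : B' = 0 by apply/matrixP => i j; rewrite !mxE oppr0.
rewrite det_ublock mulrAC det_scalar_sub_mulmxC incidence_mx_gram det_scalar.
set M := (X in \det X).
have -> : M = diag_mx (\row_j ('X + 1 - (leaves (enum_val j))%:R)).
  by apply/matrixP => i j; rewrite !mxE mulrnBl.
rewrite det_diag (eq_bigr _ (fun i _ => mxE _ _ _ _)).
rewrite -(big_enum_val (fun s => 'X + 1 - (leaves s)%:R)) /=.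
by rewrite mulrC mulrA.
Qed.

End StarForest.

Section StarSpectra.
Local Open Scope ring_scope.

Lemma prod_nseq_XsubC (R : comNzRingType) n (c : R) :
  \prod_(x <- nseq n c) ('X - x%:P) = ('X - c%:P) ^+ n.
Proof. by elim: n => [|n IHn]; rewrite ?big_nil //= big_cons IHn exprS. Qed.

(** The determinant identities come with a spurious factor ['X - c] to the power
    [k]; unique factorization into linear factors removes it. *)
Lemma eigenvalues_cancel (C : closedFieldType) n (M : 'M[C]_n) c k l rs :
  (k <= l)%N ->
  char_poly M * ('X - c%:P) ^+ k =
    ('X - c%:P) ^+ l * \prod_(x <- rs) ('X - x%:P) ->
  perm_eq (eigenvalues M) (nseq (l - k) c ++ rs).
Proof.
move=> le_kl; rewrite char_poly_eigenvalues -!prod_nseq_XsubC -!big_cat.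
move/prod_XsubC_eq; rewrite -{1}(subnK le_kl) nseqD -catA perm_sym.
by rewrite perm_catCA perm_catC perm_cat2r perm_sym.
Qed.

Section StarGraph.
Variables (C : numClosedFieldType) (L S : finType) (f : L -> S).
Variable e : sgraph (L + S)%type.
Hypothesis e_ll : forall l l', e (inl l) (inl l') = false.
Hypothesis e_ls : forall l s, e (inl l) (inr s) = (f l == s).
Hypothesis e_ss : forall s s', e (inr s) (inr s') = false.
Hypothesis leSL : (#|S| <= #|L|)%N.

Let e_sl s l : e (inr s) (inl l) = (f l == s).
Proof. by rewrite adj_sym e_ls. Qed.

Definition star_sizes : seq nat := [seq leaves f s | s : S].

Lemma star_degree_leaf l : degree e (inl l) = 1%N.
Proof.
rewrite /degree -(cards1 (inr (f l) : (L + S)%type)); apply: eq_card => -[l'|s].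
  by rewrite !inE e_ll.
by rewrite !inE e_ls eq_sym.
Qed.

Lemma star_degree_center s : degree e (inr s) = leaves f s.
Proof.
rewrite /degree /leaves -(card_imset _ (@inl_inj L S)); apply: eq_card => -[l|s'].
  by rewrite !inE e_sl mem_imset ?inE //; apply: inl_inj.
rewrite !inE e_ss; apply/esym/imsetP => -[] //.
Qed.

Lemma star_adjacency :
  adjacency_mx C e =
  \matrix_(i, j) weighted_star f 0 1 (fun=> 0) (enum_val i) (enum_val j).
Proof.
apply/matrixP => i j; rewrite !mxE.
by case: (enum_val i) (enum_val j) => [l|s] [l'|s'] /=;
   rewrite ?e_ll ?e_ls ?e_sl ?e_ss ?mul0rn.
Qed.

Lemma star_degree_mx (i j : 'I_#|{: L + S}|) :
  degree_mx C e i j =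
  weighted_star f 1 0 (fun s => (leaves f s)%:R) (enum_val i) (enum_val j).
Proof.
rewrite !mxE -(inj_eq enum_val_inj).
by case: (enum_val i) (enum_val j) => [l|s] [l'|s'] /=;
   rewrite ?star_degree_leaf ?star_degree_center ?mul0rn.
Qed.

Lemma star_laplacian :
  laplacian_mx C e = \matrix_(i, j)
    weighted_star f 1 (-1) (fun s => (leaves f s)%:R) (enum_val i) (enum_val j).
Proof.
rewrite /laplacian_mx star_adjacency; apply/matrixP => i j.
rewrite mxE star_degree_mx !mxE.
by case: (enum_val i) (enum_val j) => [l|s] [l'|s'] /=;
   rewrite ?mul0rn ?subr0 // ?sub0r mulNrn.
Qed.

Lemma star_signless_laplacian :
  signless_laplacian_mx C e = \matrix_(i, j)
    weighted_star f 1 1 (fun s => (leaves f s)%:R) (enum_val i) (enum_val j).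
Proof.
rewrite /signless_laplacian_mx star_adjacency; apply/matrixP => i j.
rewrite mxE star_degree_mx !mxE.
by case: (enum_val i) (enum_val j) => [l|s] [l'|s'] /=;
   rewrite ?mul0rn ?addr0 ?add0r.
Qed.

Lemma star_cn :
  cn_mx C e = \matrix_(i, j) common_star f C (enum_val i) (enum_val j).
Proof.
apply/matrixP => i j; rewrite !mxE -(inj_eq enum_val_inj).
case: (enum_val i) (enum_val j) => [l|s] [l'|s'] /=.
- have [[->]|neq_ll] := eqVneq; first by rewrite !eqxx subrr.
  rewrite (negPf neq_ll : (l == l') = false) subr0; congr _%:R.
  have [Ef|neq_f] := eqVneq (f l) (f l').
    rewrite /common_neighbors -[RHS](cards1 (inr (f l) : (L + S)%type)).
    apply: eq_card => -[k|s]; rewrite !inE ?e_ll ?andbF //= !e_ls -Ef andbb.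
    by rewrite eq_sym.
  apply: eq_card0 => -[k|s]; rewrite !inE ?e_ll ?andbF //= !e_ls.
  by apply: contraNF neq_f => /andP[/eqP -> /eqP ->].
- rewrite eq_card0 // => -[k|t]; rewrite !inE ?e_ll ?e_ss ?andbF //.
- rewrite eq_card0 // => -[k|t]; rewrite !inE ?e_ll ?e_ss ?andbF //.
have [//|neq_ss] := eqVneq.
rewrite eq_card0 // => -[k|t]; rewrite !inE ?e_ss ?andbF //= !e_sl.
apply: contraNF neq_ss => /andP[/eqP <- /eqP <-] //.
Qed.

Lemma star_Spec :
  perm_eq (Spec C e) (nseq (#|L| - #|S|) 0 ++
    [seq sqrtC n%:R | n <- star_sizes] ++ [seq - sqrtC n%:R | n <- star_sizes]).
Proof.
apply: (@eigenvalues_cancel _ _ _ 0 #|S|) => //.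
rewrite star_adjacency char_poly_weighted_star ?mulr1 //; congr (_ * _).
rewrite big_cat /= !big_map -!enumT !big_enum -big_split /=; apply: eq_bigr => s _.
rewrite -[(leaves f s)%:R](rmorph_nat polyC) -{1}(sqrtCK (leaves f s)%:R).
rewrite rmorphXn rmorphN rmorph0 /=; ring.
Qed.

Lemma star_laplacian_spec M eps : eps * eps = 1 ->
  M = \matrix_(i < #|{: L + S}|, j < #|{: L + S}|)
    weighted_star f 1 eps (fun s => (leaves f s)%:R) (enum_val i) (enum_val j) ->
  perm_eq (@eigenvalues C _ M) (nseq (#|L| - #|S|) 1 ++
    nseq #|S| 0 ++ [seq n%:R + 1 | n <- star_sizes]).
Proof.
move=> eps2 ->; apply: (@eigenvalues_cancel _ _ _ 1 #|S|) => //.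
rewrite char_poly_weighted_star //; congr (_ * _).
rewrite big_cat /= prod_nseq_XsubC -prodr_const !big_map -enumT big_enum -big_split /=.
apply: eq_bigr => s _.
rewrite rmorphD rmorph_nat rmorph0 rmorph1 /=; ring.
Qed.

Lemma star_L_spec :
  perm_eq (L_spec C e) (nseq (#|L| - #|S|) 1 ++
    nseq #|S| 0 ++ [seq n%:R + 1 | n <- star_sizes]).
Proof. by apply: star_laplacian_spec star_laplacian; rewrite mulrNN mulr1. Qed.

Lemma star_Q_spec :
  perm_eq (Q_spec C e) (nseq (#|L| - #|S|) 1 ++
    nseq #|S| 0 ++ [seq n%:R + 1 | n <- star_sizes]).
Proof. by apply: star_laplacian_spec star_signless_laplacian; rewrite mulr1. Qed.

Lemma star_CN_spec :
  perm_eq (CN_spec C e) (nseq (#|L| - #|S|) (-1) ++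
    nseq #|S| 0 ++ [seq n%:R - 1 | n <- star_sizes]).
Proof.
apply: (@eigenvalues_cancel _ _ _ (-1) #|S|) => //.
have -> : ('X - (-1)%:P : {poly C}) = 'X + 1 by rewrite rmorphN opprK.
rewrite star_cn char_poly_common_star mulrAC [LHS]mulrC; congr (_ * _).
rewrite big_cat /= prod_nseq_XsubC subr0 !big_map -enumT big_enum; congr (_ * _).
apply: eq_bigr => s _.
rewrite rmorphB rmorph_nat rmorph1 /=; ring.
Qed.

End StarGraph.

End StarSpectra.

(** * Generating pairs of cyclic groups *)

Section GeneratingPairs.
Import GroupScope.
Variable gT : finGroupType.
Implicit Types (H K : {group gT}) (x : gT).

Definition pair_span (u : gT * gT) : {group gT} := <<[set u.1; u.2]>>%G.

Definition gen_pairs H : nat := leaves pair_span H.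

(** Sort the pairs of elements of [H] by the subgroup that they generate. This
    gives each [gen_pairs H] from those of the proper subgroups of [H]. *)
Lemma sum_gen_pairs H :
  (\sum_(K : {group gT} | K \subset H) gen_pairs K = #|H| ^ 2)%N.
Proof.
rewrite -mulnn -cardsX -sum1_card.
rewrite [RHS](partition_big pair_span (fun K => K \subset H)) /=; last first.
  by move=> [x y]; rewrite !inE /= gen_subG subUset !sub1set.
apply: eq_bigr => K sKH; rewrite /gen_pairs /leaves -sum1dep_card.
apply: eq_bigl => -[x y]; rewrite !inE /=.
case: eqP => [EK|]; rewrite ?andbF ?andbT //.
by move: sKH; rewrite -EK /= gen_subG subUset !sub1set => ->.
Qed.

Lemma order_divisor x d : d %| #[x] -> #[x ^+ (#[x] %/ d)] = d.
Proof.
move=> d_x; have d_gt0 := dvdn_gt0 (order_gt0 x) d_x.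
rewrite orderXdiv; last by rewrite dvdn_div.
by rewrite -{1}(divnK d_x) mulKn // divn_gt0 // dvdn_leq.
Qed.

(** The subgroup of order [d] of [<[x]>], for [d] a divisor of [#[x]] *)
Definition cycle_sub x d : {group gT} := <[x ^+ (#[x] %/ d)]>%G.

Lemma cycle_subgroups_uniq x : uniq [seq cycle_sub x d | d <- divisors #[x]].
Proof.
rewrite map_inj_in_uniq ?divisors_uniq // => d d'.
rewrite -!dvdn_divisors // => d_x d'_x /(congr1 (fun H : {group gT} => #|H|)) /=.
by rewrite -!orderE !order_divisor.
Qed.

Lemma mem_cycle_subgroups x H :
  (H \in [seq cycle_sub x d | d <- divisors #[x]]) = (H \subset <[x]>).
Proof.
apply/mapP/idP => [[d _ ->]|sHx]; first by rewrite cycle_subG mem_cycle.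
exists #|H|; first by rewrite -dvdn_divisors // cardSg.
by apply/set1P; rewrite -cycle_sub_group ?inE ?sHx ?eqxx // cardSg.
Qed.

Lemma sum_gen_pairs_cycle x :
  (\sum_(d <- divisors #[x]) gen_pairs (cycle_sub x d) = #[x] ^ 2)%N.
Proof.
rewrite [in RHS]orderE -sum_gen_pairs -big_enum /=.
rewrite -(big_map (cycle_sub x) xpredT gen_pairs); apply: perm_big.
apply: uniq_perm; rewrite ?enum_uniq ?cycle_subgroups_uniq // => H.
by rewrite mem_cycle_subgroups mem_enum.
Qed.

Lemma cycle_sub_order x : cycle_sub x #[x] = <[x]>%G.
Proof. by rewrite /cycle_sub divnn order_gt0 expg1. Qed.

Lemma gen_pairs_cycle_sub1 x : gen_pairs (cycle_sub x 1) = 1%N.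
Proof.
have := sum_gen_pairs_cycle (1 : gT); rewrite order1 big_seq1.
by rewrite /cycle_sub expg1n divn1 expg_order.
Qed.

Lemma gen_pairs_prime x : prime #[x] -> gen_pairs <[x]> = (#[x] ^ 2 - 1)%N.
Proof.
move=> p_x; rewrite -sum_gen_pairs_cycle.
have Ed : perm_eq (divisors #[x]) [:: 1%N; #[x]].
  apply: uniq_perm; rewrite ?divisors_uniq //= ?inE ?andbT.
    by rewrite eq_sym neq_ltn prime_gt1 ?orbT.
  move=> d; rewrite -dvdn_divisors // !inE; apply/idP/orP => [|[]/eqP->//].
  by case/primeP: p_x => _ /[apply] /orP.
rewrite (perm_big _ Ed) !big_cons big_nil /= addn0.
by rewrite gen_pairs_cycle_sub1 cycle_sub_order addKn.
Qed.

Lemma gen_pairs_cycle_sub_prime x q :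
  prime q -> q %| #[x] -> gen_pairs (cycle_sub x q) = (q ^ 2 - 1)%N.
Proof. by move=> q_pr q_x; rewrite gen_pairs_prime order_divisor. Qed.

Lemma gen_pairs_order4 x : #[x] = 4 -> gen_pairs <[x]> = 12%N.
Proof.
move=> ox; have := sum_gen_pairs_cycle x; rewrite ox !big_cons big_nil /=.
rewrite gen_pairs_cycle_sub1 gen_pairs_cycle_sub_prime ?ox //.
rewrite -[in cycle_sub x 4]ox cycle_sub_order; lia.
Qed.

Lemma divisors_double_prime p : prime p -> (2 < p)%N ->
  perm_eq (divisors (2 * p)) [:: 1; 2; p; 2 * p]%N.
Proof.
move=> p_pr p_gt2; apply: uniq_perm; rewrite ?divisors_uniq //=.
  by rewrite !inE; lia.
move=> d; rewrite -dvdn_divisors ?muln_gt0 ?prime_gt0 // !inE.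
apply/idP/idP => [d_2p|/or4P[]/eqP->];
  [|exact: dvd1n|exact: dvdn_mulr|exact: dvdn_mull|exact: dvdnn].
have [d_p|d_p] := boolP (coprime 2 d).
  move: d_2p; rewrite Gauss_dvdr 1?coprime_sym //.
  by case/primeP: p_pr => _ /[apply] /orP[]->; rewrite ?orbT.
have /dvdnP[k Ed] : 2 %| d by rewrite -[_ %| _]negbK -prime_coprime.
move: d_2p; rewrite Ed mulnC dvdn_pmul2l //.
by case/primeP: p_pr => _ /[apply] /orP[]/eqP->; rewrite ?muln1 ?eqxx ?orbT.
Qed.

Lemma gen_pairs_double_prime x p : prime p -> (2 < p)%N -> #[x] = (2 * p)%N ->
  gen_pairs <[x]> = (3 * p ^ 2 - 3)%N.
Proof.
move=> p_pr p_gt2 ox; have := sum_gen_pairs_cycle x; rewrite ox.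
rewrite (perm_big _ (divisors_double_prime p_pr p_gt2)) !big_cons big_nil /=.
have x_2 : 2 %| #[x] by rewrite ox dvdn_mulr.
have x_p : p %| #[x] by rewrite ox dvdn_mull.
rewrite gen_pairs_cycle_sub1 (gen_pairs_cycle_sub_prime _ x_2) //.
rewrite (gen_pairs_cycle_sub_prime p_pr x_p).
have -> : cycle_sub x (2 * p) = <[x]>%G by rewrite -ox cycle_sub_order.
have : (2 < p ^ 2)%N by rewrite -mulnn; nia.
rewrite expnMn; lia.
Qed.

End GeneratingPairs.

(** * The structure of dicyclic groups *)

(** The model is the set of words [a ^+ i * b ^+ e], with [i] modulo [2 * m] and
    [e] a bit, on which [a] and [b] act by right multiplication. As the
    composite of permutations [s * t] applies [s] first, right translations
    multiply in the same order as the elements that they come from. *)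
Section DicyclicModel.
Variable m : nat.
Hypothesis m_gt0 : (0 < m)%N.
Local Open Scope ring_scope.

Let T : finType := ('Z_(2 * m) * bool)%type.

Definition model_a_fun (u : T) : T := (if u.2 then u.1 - 1 else u.1 + 1, u.2).
Definition model_b_fun (u : T) : T := (if u.2 then u.1 + m%:R else u.1, ~~ u.2).

Let char_2m : (2 * m)%:R = 0 :> 'Z_(2 * m).
Proof. by apply: pchar_Zp; lia. Qed.

Lemma model_a_inj : injective model_a_fun.
Proof. by move=> [i []] [j []] // /(congr1 fst) /= /addIr ->. Qed.

Lemma model_b_inj : injective model_b_fun.
Proof. by move=> [i []] [j []] // /(congr1 fst) /= => [/addIr|] ->. Qed.

Definition model_a : {perm T} := perm model_a_inj.
Definition model_b : {perm T} := perm model_b_inj.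

Lemma model_aX k (u : T) :
  (model_a ^+ k)%g u = (if u.2 then u.1 - k%:R else u.1 + k%:R, u.2).
Proof.
case: u => i e; elim: k => [|k IHk].
  by rewrite expg0 perm1 /= subr0 addr0; case: e.
rewrite expgSr permM IHk permE /model_a_fun /=.
by case: e {IHk}; rewrite -natr1 ?opprD addrA.
Qed.

Lemma model_homg : (<[model_a]> <*> <[model_b]> \homg Grp (a : b :
  (a ^+ (2 * m)%N = 1, b ^+ 2 = a ^+ m, b * a * b^-1 = a^-1)))%g.
Proof.
apply/existsP; exists (model_a, model_b); rewrite /= !xpair_eqE eqxx /=.
apply/and3P; split.
- apply/eqP/permP => -[i e]; rewrite model_aX perm1 /= char_2m subr0 addr0.
  by case: e.
- apply/eqP/permP => -[i e].
  rewrite model_aX expgS expg1 permM !permE /model_b_fun /=.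
  case: e => //=; congr (_, _); apply/eqP; rewrite -subr_eq0 opprB.
  by rewrite [m%:R - i]addrC addrACA subrr add0r -natrD addnn -mul2n char_2m.
have aba : (model_a * model_b * model_a = model_b)%g.
  apply/permP => -[i e]; rewrite !permM !permE /model_a_fun /model_b_fun /=.
  by case: e => /=; congr (_, _); rewrite ?addrK // addrAC subrK.
by rewrite eq_sym eq_invg_mul !mulgA aba mulgV.
Qed.

(** The orbit of the empty word [(0, false)] is the whole set of words. *)
Lemma model_card : (4 * m <= #|<[model_a]> <*> <[model_b]>|)%g%N.
Proof.
pose h (g : {perm T}) := g (0, false).
apply: leq_trans (leq_imset_card h _); apply: leq_trans (_ : #|T| <= _)%N.
  rewrite card_prod card_bool card_ord Zp_cast; lia.
apply: subset_leq_card; apply/subsetP => -[i e] _; apply/imsetP.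
have aG : (model_a \in <[model_a]> <*> <[model_b]>)%g.
  by rewrite mem_gen // inE cycle_id.
have bG : (model_b \in <[model_a]> <*> <[model_b]>)%g.
  by rewrite mem_gen // inE cycle_id orbT.
exists ((model_a ^+ val i * model_b ^+ e)%g); first by rewrite groupM ?groupX.
rewrite /h permM model_aX /= add0r natr_Zp.
by case: e; rewrite ?expg1 ?expg0 ?permE.
Qed.

End DicyclicModel.

Section Dicyclic.
Import GroupScope.
Variables (m : nat) (gT : finGroupType).
Hypothesis m_gt0 : (0 < m)%N.
Hypothesis G_dicyclic : dicyclic m gT.

Lemma dicyclic_generators : exists a b : gT,
  [/\ <[a]> <*> <[b]> = [set: gT], a ^+ (2 * m) = 1, b ^+ 2 = a ^+ m &
     b * a * b^-1 = a^-1].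
Proof.
have /existsP[[a b] /=] := isoGrp_hom G_dicyclic.
by rewrite !xpair_eqE => /and4P[/eqP ? /eqP ? /eqP ? /eqP ?]; exists a, b.
Qed.

(** By the universal property of the presentation, the model is a homomorphic
    image of the dicyclic group. *)
Lemma dicyclic_card_ge : (4 * m <= #|gT|)%N.
Proof.
apply: leq_trans (model_card m_gt0) _.
rewrite -cardsT; apply: dvdn_leq; first exact: cardG_gt0.
by apply: card_homg; rewrite (G_dicyclic (<[_]> <*> <[_]>)%G) model_homg.
Qed.

End Dicyclic.

Section DicyclicPairs.
Import GroupScope.

(** An internal form of the presentation, in which the orders are known and every
    element is [a ^+ i] or [a ^+ i * b]. *)
Definition dicyclic_pair (m : nat) (gT : finGroupType) (a b : gT) : Prop :=
  [/\ #[a] = (2 * m)%N, b \notin <[a]>, b ^+ 2 = a ^+ m, b * a * b^-1 = a^-1 &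
     [set: gT] = <[a]> :|: <[a]> :* b].

(** The relations bound the order of the group by twice the order of [a], hence
    by [4 * m]; the model shows that this bound is attained, which forces [a] to
    have order [2 * m] and [b] to lie outside [<[a]>]. *)
Lemma dicyclic_pairP (m : nat) (gT : finGroupType) :
  (0 < m)%N -> dicyclic m gT -> exists a b : gT, dicyclic_pair m a b.
Proof.
move=> m_gt0 G_dic; have [a [b [genG a2m b2 bab]]] := dicyclic_generators G_dic.
have nab : b \in 'N(<[a]>).
  rewrite -groupV inE -cycleJ conjgE invgK mulgA bab.
  by rewrite cycle_subG groupV cycle_id.
have defG : [set: gT] = <[a]> :|: <[a]> :* b.
  apply/eqP; rewrite eqEsubset subsetT andbT -genG norm_joinEr ?cycle_subG //.
  apply/subsetP => _ /mulsgP[x _ xa /cycleP[k ->] ->]; rewrite !inE mem_rcoset.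
  rewrite -[k]odd_double_half addnC expgD -mul2n expgM b2 -expgM mulgA.
  have xaX i : x * a ^+ i \in <[a]> by rewrite groupM ?groupX ?cycle_id.
  by case: (odd k); rewrite /= ?expg0 ?expg1 ?mulg1 ?mulgK xaX ?orbT.
have leG : (#|gT| <= #[a] + #|<[a]> :* b|)%N.
  by rewrite -cardsT defG cardsU leq_subr.
have ge4m := dicyclic_card_ge m_gt0 G_dic.
rewrite card_rcoset -orderE in leG.
have le_a : (#[a] <= 2 * m)%N by rewrite dvdn_leq ?order_dvdn ?a2m // muln_gt0.
have oa : #[a] = (2 * m)%N by lia.
exists a, b; split=> //; apply/negP => ab.
have : #|gT| = #[a] by rewrite -cardsT defG rcoset_id // setUid.
lia.
Qed.

End DicyclicPairs.

(** * Subgroups and generating pairs of dicyclic groups *)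

Section Subgroups.
Import GroupScope.
Variables (m : nat) (gT : finGroupType) (a b : gT).
Hypothesis m_gt0 : (0 < m)%N.
Hypothesis ab_pair : dicyclic_pair m a b.

Let oa : #[a] = (2 * m)%N. Proof. by case: ab_pair. Qed.
Let b_notin : b \notin <[a]>. Proof. by case: ab_pair. Qed.
Let b2 : b ^+ 2 = a ^+ m. Proof. by case: ab_pair. Qed.

Lemma dicyclic_card : #|gT| = (4 * m)%N.
Proof.
have [_ _ _ _ defG] := ab_pair.
rewrite -cardsT defG cardsU card_rcoset -orderE oa.
rewrite disjoint_setI0 ?cards0; first by rewrite subn0 addnn -mul2n mulnA.
rewrite disjoint_sym; apply/pred0P => x /=; apply/negP => /andP[].
by rewrite mem_rcoset => xb xa; case/negP: b_notin; rewrite -groupV -(groupMl _ xa).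
Qed.

Lemma outside_cycleP x : x \notin <[a]> -> exists i, x = a ^+ i * b.
Proof.
have [_ _ _ _ defG] := ab_pair; have := in_setT x; rewrite defG inE.
case/orP=> [-> //|]; rewrite mem_rcoset => /cycleP[i Ei] _.
by exists i; rewrite -Ei mulgKV.
Qed.

Lemma aXb_notin i : a ^+ i * b \notin <[a]>.
Proof. by rewrite groupMl ?mem_cycle. Qed.

(** Conjugation by [b] inverts [a ^+ i], so the two powers of [a] cancel and only
    [b ^+ 2] is left. *)
Lemma aXb_sqr i : (a ^+ i * b) ^+ 2 = a ^+ m.
Proof.
have [_ _ _ bab _] := ab_pair.
have conj_b : b * a ^+ i = a ^- i * b.
  rewrite -(mulgKV b (b * _)); congr (_ * b).
  rewrite -mulgA -{1}[b]invgK -conjgE conjXg conjgE invgK mulgA bab.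
  by rewrite expgVn.
by rewrite expgS expg1 mulgA -[_ * b * _]mulgA conj_b mulgA mulgV mul1g.
Qed.

Lemma am_sqr : (a ^+ m) ^+ 2 = 1.
Proof. by rewrite -expgM mulnC -oa expg_order. Qed.

Lemma am_neq1 : a ^+ m != 1.
Proof. by rewrite -order_dvdn oa gtnNdvd //; lia. Qed.

Lemma order_aXb i : #[a ^+ i * b] = 4.
Proof.
have o4 : #[a ^+ i * b] %| 2 ^ 2.
  by rewrite order_dvdn (expgM _ 2 2) aXb_sqr am_sqr.
have /(dvdn_pfactor _ _ (isT : prime 2))[[|[|[|]]] // _ Eo] := o4.
- by have := am_neq1; rewrite -(aXb_sqr i) -order_dvdn Eo.
by have := am_neq1; rewrite -(aXb_sqr i) -order_dvdn Eo.
Qed.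

Lemma am_in_aXb i : a ^+ m \in <[a ^+ i * b]>.
Proof. by rewrite -(aXb_sqr i) mem_cycle. Qed.

Definition order4_sub i : {group gT} := <[a ^+ i * b]>%G.

(** [a ^+ m] is the square of [a ^+ i * b], so adding a multiple of [m] to [i]
    stays within the same subgroup. *)
Lemma order4_sub_mod i : order4_sub i = order4_sub (i %% m).
Proof.
apply/val_inj/eqP; rewrite /= eqEcard cycle_subG -!orderE !order_aXb leqnn andbT.
rewrite {1}(divn_eq i m) expgD -mulgA groupM ?cycle_id //.
by rewrite mulnC expgM groupX ?am_in_aXb.
Qed.

(** Inside [<[a ^+ i * b]>] the odd powers of the generator lie outside [<[a]>],
    and the even ones are powers of the involution [a ^+ m]. *)
Lemma order4_sub_sqr i x :
  x \in order4_sub i -> x \in <[a]> -> x ^+ 2 = 1.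
Proof.
move=> /cycleP[k ->]; rewrite -[k]odd_double_half expgD -mul2n expgM aXb_sqr.
case: (odd k); last by rewrite expg0 mul1g => _; rewrite expgAC am_sqr expg1n.
by rewrite /= expg1 groupMr ?groupX ?cycle_id // (negPf (aXb_notin i)).
Qed.

(** If [a ^+ i * b] and [a ^+ j * b] generate the same subgroup, their quotient
    [a ^+ i * a ^- j] lies both in it and in [<[a]>], so its square is [1]. *)
Lemma order4_sub_inj : {in gtn m &, injective order4_sub}.
Proof.
move=> i j; rewrite !inE => lt_i lt_j Eij.
have ai : a ^+ i * b \in order4_sub j by rewrite -Eij cycle_id.
have aij : a ^+ i * a ^- j \in order4_sub j.
  rewrite -(mulgK b (a ^+ i)) -mulgA -invMg groupM ?groupV ?cycle_id //.
have := order4_sub_sqr aij; rewrite groupM ?groupV ?mem_cycle //.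
move/(_ isT)/eqP; rewrite expgMn; last by apply: commuteV; apply: commuteX2.
rewrite expgVn -!expgM -eq_mulgV1 eq_expg_mod_order oa !modn_small; lia.
Qed.

End Subgroups.

Section PrimeCase.
Import GroupScope.
Variables (p : nat) (gT : finGroupType) (a b : gT).
Hypothesis p_pr : prime p.
Hypothesis ab_pair : dicyclic_pair p a b.
Let p_gt0 := prime_gt0 p_pr.

(** A subgroup [H] that contains some [x] outside [<[a]>] contains its square
    [a ^+ p], so [H :&: <[a]>] has order [2] or [2 * p] because [p] is prime. In
    the first case this intersection is generated by [x ^+ 2], and as [<[a]>]
    has index [2], [H = <[x]>]; in the second [H] contains both [a] and [b]. *)
Lemma dicyclic_subgroupP (H : {group gT}) :
  [\/ H \subset <[a]>, exists2 i, (i < p)%N & H = order4_sub a b i |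
      H = [set: gT]%G].
Proof.
have [oa b_notin b2 bab defG] := ab_pair.
have [sHa|] := boolP (H \subset <[a]>); first by apply: Or31.
case/subsetPn => x Hx xa; have [i Ex] := outside_cycleP ab_pair xa.
have z_in : a ^+ p \in H :&: <[a]>.
  by rewrite inE mem_cycle -(aXb_sqr ab_pair i) -Ex groupX.
have oz : #[a ^+ p] = 2.
  by rewrite orderXdiv oa ?dvdn_mull // mulnK.
have sz : <[a ^+ p]> \subset H :&: <[a]> by rewrite cycle_subG.
have /dvdnP[k Ek] : 2 %| #|H :&: <[a]>| by rewrite -oz; apply: cardSg sz.
have : #|H :&: <[a]>| %| 2 * p by rewrite -oa cardSg ?subsetIr.
rewrite Ek mulnC dvdn_pmul2l //; have /primeP[_ dvd_p] := p_pr.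
case/dvd_p/orP=> /eqP k_eq.
  have EHa : H :&: <[a]> = <[a ^+ p]>.
    by apply/eqP; rewrite eq_sym eqEcard sz Ek k_eq -orderE oz.
  apply: Or32; exists (i %% p); rewrite ?ltn_mod // -order4_sub_mod //.
  apply/val_inj/eqP; rewrite /= eqEsubset cycle_subG -Ex Hx andbT.
  have sHax : H :&: <[a]> \subset <[x]>.
    by rewrite EHa cycle_subG Ex am_in_aXb.
  apply/subsetP => y Hy; have [ya|ya] := boolP (y \in <[a]>).
    by apply: (subsetP sHax); rewrite inE Hy.
  have [j Ey] := outside_cycleP ab_pair ya.
  rewrite -(mulgKV x y) groupMr ?cycle_id //; apply: (subsetP sHax).
  rewrite inE groupM ?groupV //= {1}Ey Ex invMg mulgA mulgK.
  by rewrite groupM ?groupV ?mem_cycle.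
apply: Or33; apply/val_inj/eqP; rewrite /= eqEsubset subsetT defG.
have saH : <[a]> \subset H.
  have /eqP <- : H :&: <[a]> == <[a]>; last exact: subsetIl.
  by rewrite eqEcard subsetIr Ek k_eq -orderE oa mulnC leqnn.
rewrite /= subUset saH mul_subG // sub1set.
by move: Hx; rewrite Ex groupMl // (subsetP saH) ?mem_cycle.
Qed.

Definition dicyclic_subgroups : seq {group gT} :=
  [seq cycle_sub a d | d <- divisors #[a]] ++
  [seq order4_sub a b i | i <- iota 0 p] ++ [:: [set: gT]%G].

Lemma enum_dicyclic_subgroups : perm_eq (enum {group gT}) dicyclic_subgroups.
Proof.
have [oa b_notin _ _ _] := ab_pair.
apply: uniq_perm; first exact: enum_uniq.
  rewrite cat_uniq cycle_subgroups_uniq cats1 rcons_uniq.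
  apply/and3P; split=> //; last first.
  - apply/andP; split.
      apply/mapP => -[i _ /(congr1 (fun H : {group gT} => #|H|))] /=.
      rewrite -orderE (order_aXb p_gt0 ab_pair) cardsT (dicyclic_card ab_pair).
      by have := prime_gt1 p_pr; lia.
    rewrite map_inj_in_uniq ?iota_uniq // => i j.
    by rewrite !mem_iota; apply: order4_sub_inj.
  apply/hasPn => H; rewrite mem_rcons inE mem_cycle_subgroups.
  case/orP=> [/eqP->|/mapP[i _ ->]].
    by apply: contra b_notin => /subsetP; apply; rewrite inE.
  by rewrite cycle_subG (aXb_notin ab_pair).
move=> H; rewrite mem_enum mem_cat mem_cat mem_cycle_subgroups.
case: (dicyclic_subgroupP H) => [->|[i lt_i ->]|->];
  rewrite ?mem_head ?orbT ?inE //.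
by rewrite map_f ?orbT // mem_iota.
Qed.

(** The [(4 * p) ^ 2] pairs of elements, less the [(2 * p) ^ 2] pairs inside
    [<[a]>] and the [12] generating pairs of each of the [p] subgroups of order
    [4] outside it *)
Lemma gen_pairs_dicyclic_whole :
  gen_pairs [set: gT]%G = (12 * p ^ 2 - 12 * p)%N.
Proof.
have := sum_gen_pairs [set: gT]%G; rewrite cardsT (dicyclic_card ab_pair).
under eq_bigl do rewrite subsetT.
rewrite -big_enum (perm_big _ enum_dicyclic_subgroups) !big_cat big_seq1 /=.
rewrite !big_map sum_gen_pairs_cycle.
under eq_bigr do rewrite (gen_pairs_order4 (order_aXb p_gt0 ab_pair _)).
have [-> _ _ _ _] := ab_pair.
rewrite big_const_seq count_predT size_iota iter_addn_0; lia.
Qed.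

Lemma dicyclic_star_sizes :
  perm_eq (star_sizes (@pair_span gT))
    ([seq gen_pairs (cycle_sub a d) | d <- divisors #[a]] ++
     nseq p 12 ++ [:: 12 * p ^ 2 - 12 * p])%N.
Proof.
rewrite /star_sizes /image_mem.
rewrite (perm_trans (perm_map _ enum_dicyclic_subgroups)) //.
rewrite !map_cat -!map_comp -gen_pairs_dicyclic_whole perm_cat2l perm_cat2r.
set s := map _ _.
have -> : nseq p 12%N = nseq (size s) 12%N by rewrite size_map size_iota.
rewrite (elimT (all_pred1P 12%N s)) ?size_nseq //.
apply/allP => _ /mapP[i _ ->] /=.
by rewrite -(gen_pairs_order4 (order_aXb p_gt0 ab_pair i)).
Qed.

End PrimeCase.

(** * Spectra of the subgroup generating bipartite graph *)

Local Open Scope ring_scope.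

Lemma sgbg_spectra (C : numClosedFieldType) (gT : finGroupType) (ns : seq nat) :
  perm_eq (star_sizes (@pair_span gT)) ns -> (size ns <= #|gT| ^ 2)%N ->
  let k := (#|gT| ^ 2 - size ns)%N in
  [/\ perm_eq (Spec C (sgbg gT)) (nseq k 0 ++
        [seq sqrtC n%:R | n <- ns] ++ [seq - sqrtC n%:R | n <- ns]),
      perm_eq (L_spec C (sgbg gT)) (nseq k 1 ++ nseq (size ns) 0 ++
        [seq n%:R + 1 | n <- ns]),
      perm_eq (Q_spec C (sgbg gT)) (nseq k 1 ++ nseq (size ns) 0 ++
        [seq n%:R + 1 | n <- ns])
    & perm_eq (CN_spec C (sgbg gT)) (nseq k (-1) ++ nseq (size ns) 0 ++
        [seq n%:R - 1 | n <- ns])].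
Proof.
move=> sizes_ns; have /perm_size := sizes_ns.
rewrite /star_sizes size_map -cardE => <-.
have -> : (#|gT| ^ 2 = #|{: gT * gT}|)%N by rewrite card_prod mulnn.
move=> leSL.
have e_ll l l' : sgbg gT (inl l) (inl l') = false by case: l l' => ? ? [].
have e_ls l s : sgbg gT (inl l) (inr s) = (pair_span l == s) by case: l.
have e_ss s s' : sgbg gT (inr s) (inr s') = false by [].
split.
- apply: perm_trans (star_Spec C e_ll e_ls e_ss leSL) _.
  by rewrite perm_cat2l perm_cat ?perm_map.
- apply: perm_trans (star_L_spec C e_ll e_ls e_ss leSL) _.
  by rewrite !perm_cat2l perm_map.
- apply: perm_trans (star_Q_spec C e_ll e_ls e_ss leSL) _.
  by rewrite !perm_cat2l perm_map.
apply: perm_trans (star_CN_spec C e_ll e_ls e_ss leSL) _.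
by rewrite !perm_cat2l perm_map.
Qed.

(** For [p = 2] the primes [2] and [p] coincide and [<[a]>] is itself of order
    [4], which is why this case is listed apart. *)
Lemma star_sizes_Q8 (gT : finGroupType) : dicyclic 2 gT ->
  perm_eq (star_sizes (@pair_span gT)) ([:: 1; 3; 24] ++ nseq 3 12)%N.
Proof.
move=> /dicyclic_pairP[//|a [b ab_pair]].
have [oa _ _ _ _] := ab_pair; have {}oa : #[a]%g = 4%N by rewrite oa.
have sizes := dicyclic_star_sizes (isT : prime 2) ab_pair.
apply: perm_trans sizes _.
rewrite oa /= gen_pairs_cycle_sub1 gen_pairs_cycle_sub_prime ?oa //.
by rewrite -[in cycle_sub a 4%N]oa cycle_sub_order gen_pairs_order4.
Qed.

Lemma star_sizes_dicyclic (p : nat) (gT : finGroupType) :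
  prime p -> (2 < p)%N -> dicyclic p gT ->
  perm_eq (star_sizes (@pair_span gT))
    ([:: 1; 3; p ^ 2 - 1; 3 * p ^ 2 - 3; 12 * p ^ 2 - 12 * p] ++ nseq p 12)%N.
Proof.
move=> p_pr p_gt2 /(dicyclic_pairP (prime_gt0 p_pr))[a [b ab_pair]].
have [oa _ _ _ _] := ab_pair.
apply: perm_trans (dicyclic_star_sizes p_pr ab_pair) _.
have a_2 : (2 %| #[a]%g)%N by rewrite oa dvdn_mulr.
have a_p : (p %| #[a]%g)%N by rewrite oa dvdn_mull.
have Ed := divisors_double_prime p_pr p_gt2.
rewrite oa; move/(perm_map (fun d => gen_pairs (cycle_sub a d))): Ed.
rewrite -(perm_cat2r (nseq p 12 ++ [:: 12 * p ^ 2 - 12 * p])%N).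
move/perm_trans; apply.
rewrite /= gen_pairs_cycle_sub1 (gen_pairs_cycle_sub_prime _ a_2) //.
rewrite (gen_pairs_cycle_sub_prime p_pr a_p) -{1}oa cycle_sub_order.
rewrite (gen_pairs_double_prime p_pr p_gt2 oa) !perm_cons.
by rewrite -[X in perm_eq _ X]cat1s perm_catC.
Qed.

Lemma natr_star_sizes (R : comNzRingType) p : (0 < p)%N ->
  [/\ (p ^ 2 - 1)%:R = p%:R ^+ 2 - 1 :> R,
      (3 * p ^ 2 - 3)%:R = 3 * p%:R ^+ 2 - 3 :> R &
      (12 * p ^ 2 - 12 * p)%:R = 12 * p%:R ^+ 2 - 12 * p%:R :> R].
Proof.
move=> p_gt0; have le_p : (p <= p ^ 2)%N by rewrite -mulnn leq_pmulr.
by split; rewrite natrB ?natrM ?natrX ?natrM //; lia.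
Qed.

Lemma count_tally_seq (T : eqType) (P : pred T) x n bs :
  count P (tally_seq ((x, n) :: bs)) = (P x * n + count P (tally_seq bs))%N.
Proof. by rewrite -count_nseq -count_cat. Qed.

Ltac perm_by_count :=
  apply/seq.permP => P;
  rewrite !count_tally_seq !count_cat !count_nseq /= ?count_cat ?count_nseq;
  repeat match goal with |- context [nat_of_bool ?c] =>
    let n := fresh in generalize (nat_of_bool c) => n end; lia.

(** The lists below are compared for arbitrary entries, so that coincidences
    between eigenvalues for a particular [p] need no discussion. *)
Section ListRearrangements.
Variables (T : eqType) (k l q : nat).
Variables z o m u v w x y u' v' w' x' y' t t' : T.

Lemma perm_Spec_Q8 :
  perm_eq (nseq k z ++ ([:: o; u; v] ++ nseq 3 t) ++ ([:: m; u'; v'] ++ nseq 3 t'))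
    (tally_seq [:: (z, k); (m, 1); (o, 1); (u', 1); (u, 1); (t', 3); (t, 3);
                   (v', 1); (v, 1)]%N).
Proof. perm_by_count. Qed.

Lemma perm_L_spec_Q8 :
  perm_eq (nseq k o ++ nseq l z ++ ([:: u; v; w] ++ nseq 3 t))
    (tally_seq [:: (z, l); (o, k); (u, 1); (v, 1); (t, 3); (w, 1)]%N).
Proof. perm_by_count. Qed.

Lemma perm_CN_spec_Q8 :
  perm_eq (nseq k m ++ nseq l z ++ ([:: z; u; v] ++ nseq 3 t))
    (tally_seq [:: (m, k); (z, l.+1); (u, 1); (t, 3); (v, 1)]%N).
Proof. perm_by_count. Qed.

Lemma perm_Spec :
  perm_eq (nseq k z ++ ([:: o; u; v; w; x] ++ nseq q t) ++
                       ([:: m; u'; v'; w'; x'] ++ nseq q t'))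
    (tally_seq [:: (m, 1); (z, k); (o, 1); (u', 1); (u, 1); (t', q); (t, q);
       (v', 1); (v, 1); (w', 1); (w, 1); (x', 1); (x, 1)]%N).
Proof. perm_by_count. Qed.

Lemma perm_L_spec :
  perm_eq (nseq k o ++ nseq l z ++ ([:: u; v; w; x; y] ++ nseq q t))
    (tally_seq [:: (z, l); (o, k); (u, 1); (v, 1); (t, q); (w, 1); (x, 1);
                   (y, 1)]%N).
Proof. perm_by_count. Qed.

Lemma perm_CN_spec :
  perm_eq (nseq k m ++ nseq l z ++ ([:: z; u; v; w; x] ++ nseq q t))
    (tally_seq [:: (m, k); (z, l.+1); (u, 1); (t, q); (v, 1); (w, 1);
                   (x, 1)]%N).
Proof. perm_by_count. Qed.

End ListRearrangements.

Theorem theorem4p1 (C : numClosedFieldType) (p : nat) (gT : finGroupType)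
    (p_prime : prime p) (G_dicyclic : dicyclic p gT) :
  (p = 2%N ->
    [/\ perm_eq (Spec C (sgbg gT))
          (tally_seq [:: (0, 58%N); (-1, 1%N); (1, 1%N);
             (- sqrtC 3, 1%N); (sqrtC 3, 1%N);
             (- sqrtC 12, 3%N); (sqrtC 12, 3%N);
             (- sqrtC 24, 1%N); (sqrtC 24, 1%N)]),
        perm_eq (L_spec C (sgbg gT))
          (tally_seq [:: (0, 6%N); (1, 58%N); (2, 1%N); (4, 1%N);
             (13, 3%N); (25, 1%N)]),
        perm_eq (Q_spec C (sgbg gT))
          (tally_seq [:: (0, 6%N); (1, 58%N); (2, 1%N); (4, 1%N);
             (13, 3%N); (25, 1%N)])
      & perm_eq (CN_spec C (sgbg gT))
          (tally_seq [:: (-1, 58%N); (0, 7%N); (2, 1%N); (11, 3%N);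
             (23, 1%N)])])
  /\
  ((3 <= p)%N ->
    [/\ perm_eq (Spec C (sgbg gT))
          (tally_seq [:: (-1, 1%N); (0, (16 * p ^ 2 - p - 5)%N); (1, 1%N);
             (- sqrtC 3, 1%N); (sqrtC 3, 1%N);
             (- sqrtC 12, p); (sqrtC 12, p);
             (- sqrtC (p%:R ^+ 2 - 1), 1%N); (sqrtC (p%:R ^+ 2 - 1), 1%N);
             (- sqrtC (3 * p%:R ^+ 2 - 3), 1%N);
             (sqrtC (3 * p%:R ^+ 2 - 3), 1%N);
             (- sqrtC (12 * p%:R ^+ 2 - 12 * p%:R), 1%N);
             (sqrtC (12 * p%:R ^+ 2 - 12 * p%:R), 1%N)]),
        perm_eq (L_spec C (sgbg gT))
          (tally_seq [:: (0, (p + 5)%N); (1, (16 * p ^ 2 - p - 5)%N);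
             (2, 1%N); (4, 1%N); (13, p); (p%:R ^+ 2, 1%N);
             (3 * p%:R ^+ 2 - 2, 1%N);
             (12 * p%:R ^+ 2 - 12 * p%:R + 1, 1%N)]),
        perm_eq (Q_spec C (sgbg gT))
          (tally_seq [:: (0, (p + 5)%N); (1, (16 * p ^ 2 - p - 5)%N);
             (2, 1%N); (4, 1%N); (13, p); (p%:R ^+ 2, 1%N);
             (3 * p%:R ^+ 2 - 2, 1%N);
             (12 * p%:R ^+ 2 - 12 * p%:R + 1, 1%N)])
      & perm_eq (CN_spec C (sgbg gT))
          (tally_seq [:: (-1, (16 * p ^ 2 - p - 5)%N); (0, (p + 6)%N);
             (2, 1%N); (11, p); (p%:R ^+ 2 - 2, 1%N);
             (3 * p%:R ^+ 2 - 4, 1%N);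
             (12 * p%:R ^+ 2 - 12 * p%:R - 1, 1%N)])]).
Proof.
have oG : #|gT| = (4 * p)%N.
  have [a [b ab_pair]] := dicyclic_pairP (prime_gt0 p_prime) G_dicyclic.
  exact: dicyclic_card ab_pair.
have succ1 n : n.+1%:R - 1 = n%:R :> C by rewrite -natr1 addrK.
split=> [p2|p_gt2].
  rewrite p2 in G_dicyclic oG.
  have /(sgbg_spectra C) := star_sizes_Q8 G_dicyclic.
  rewrite oG => -[//|].
  rewrite !map_cat !map_nseq !map_cons /map sqrtC1 !natr1 !succ1.
  move=> SpecG LG QG CNG; split.
  - by apply: perm_trans SpecG _; apply: perm_Spec_Q8.
  - by apply: perm_trans LG _; apply: perm_L_spec_Q8.
  - by apply: perm_trans QG _; apply: perm_L_spec_Q8.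
  - by apply: perm_trans CNG _; apply: perm_CN_spec_Q8.
have /(sgbg_spectra C) := star_sizes_dicyclic p_prime p_gt2 G_dicyclic.
have [E1 E2 E3] := natr_star_sizes C (prime_gt0 p_prime).
have le_p : (3 * p <= p ^ 2)%N by rewrite -mulnn leq_mul2r p_gt2 orbT.
have s32 (r : C) : r - 3 + 1 = r - 2 by ring.
have s34 (r : C) : r - 3 - 1 = r - 4 by ring.
have s12 (r : C) : r - 1 - 1 = r - 2 by ring.
rewrite oG size_cat size_nseq expnMn => -[/=|]; first by lia.
rewrite !map_cat !map_nseq !map_cons /map sqrtC1 E1 E2 E3.
rewrite !s32 !s34 !s12 !subrK !natr1 !succ1.
have -> : (4 ^ 2 * p ^ 2 - (5 + p) = 16 * p ^ 2 - p - 5)%N.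
  by rewrite addnC subnDA.
rewrite (addnC 5 p) => SpecG LG QG CNG; split.
- by apply: perm_trans SpecG _; apply: perm_Spec.
- by apply: perm_trans LG _; apply: perm_L_spec.
- by apply: perm_trans QG _; apply: perm_L_spec.
rewrite (addnS p 5); by apply: perm_trans CNG _; apply: perm_CN_spec.
Qed.
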